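(* Let $0<T<+\infty$, let $P\in\mathbb R^{n\times n}$ be symmetric positive definite, let $g^1,\dots,g^r$ be smooth vector fields on $\mathbb R^n$, and consider the driftless problem $$J_0^T(u)=\int_0^Tx(t)'Px(t)\,dt\to\min,\qquad \dot x=\sum_{j=1}^rg^j(x)u_j,\quad x(0)=x_0,\quad x(T)=x_T.$$ Let $\mathcal A_{x_0}$ be the attainable set of the control system from $x_0$ (i.e. the set of points which can be reached from $x_0$ through trajectories of the system), let $x_T\in\mathcal A_{x_0}$ and $$\alpha=\inf\{x'Px:\ x\in\mathcal A_{x_0}\}.$$ Let $\sigma_T$ be the degree of singularity of the problem. Then: i) $\inf J_0^T=\alpha T$; ii) $\sigma_T\ge\frac12$ unless $x_0'Px_0=x_T'Px_T=\alpha$; iii) if the infimum defining $\alpha$ is attained, then $\sigma_T\le\frac12$.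
   Context: Controls are $u\in L_2^r[0,T]$, with trajectory $x_u$; $\inf J_0^T$ is the infimum over controls with $x_u(T)=x_T$. Degree of singularity: $$\sigma_T=\limsup_{\varepsilon\to0^+}\frac{\inf\{\ln\|u\|_{L_2}:\ J_0^T(u)\le\inf J_0^T+\varepsilon,\ |x_u(T)-x_T|<\varepsilon\}}{\ln\frac1\varepsilon}\qquad(\ln0=-\infty).$$ *)

(* Defs.v *)
From HB Require Import structures.
From mathcomp Require Export all_boot all_order all_algebra.
From mathcomp Require Export all_classical all_reals all_analysis.
Export Order.TTheory GRing.Theory Num.Theory.
Export numFieldNormedType.Exports.

Set Implicit Arguments.
Unset Strict Implicit.
Unset Printing Implicit Defensive.

Local Open Scope classical_set_scope.
Local Open Scope ring_scope.

Section Vectors.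
Context {R : realType}.

(* The library norm `|v| on matrices is the sup norm. *)
Definition enorm {n : nat} (v : 'cV[R]_n) : R :=
  Num.sqrt (\sum_(i < n) v i 0 ^+ 2).

Definition qform {n : nat} (P : 'M[R]_n) (v : 'cV[R]_n) : R :=
  (v^T *m P *m v) 0 0.

Definition posdef_sym {n : nat} (P : 'M[R]_n) : Prop :=
  P^T = P /\ forall v : 'cV[R]_n, v != 0 -> 0 < qform P v.

Fixpoint class_C {n m : nat} (k : nat) (f : 'cV[R]_n -> 'cV[R]_m) : Prop :=
  if k is k'.+1 then
    continuous f /\
    forall i : 'I_n, (forall x, derivable f x (delta_mx i 0)) /\
                     class_C k' (fun x => 'D_(delta_mx i 0) f x)
  else continuous f.

Definition smooth {n m : nat} (f : 'cV[R]_n -> 'cV[R]_m) : Prop :=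
  forall k : nat, class_C k f.

End Vectors.

Section ControlSystem.
Context {R : realType} {n r : nat}.
Implicit Types (g : 'I_r -> 'cV[R]_n -> 'cV[R]_n) (P : 'M[R]_n).
Implicit Types (u : R -> 'cV[R]_r) (x : R -> 'cV[R]_n) (S T eps : R).

Local Notation mu := (@lebesgue_measure R).

(* Only the values of [u] on [0, S] matter. *)
Definition L2_control S u : Prop :=
  forall j : 'I_r, ((fun t => u t j 0) \_ `[0, S]) \in Lfun mu 2%:E.

Definition L2norm S u : \bar R :=
  ('N[mu]_2%:E [EFin \o ((fun t => enorm (u t)) \_ `[0%R, S])])%E.

Definition velocity g u x (t : R) : 'cV[R]_n :=
  \sum_(j < r) u t j 0 *: g j (x t).

(* Solutions are meant in the sense of Caratheodory: the integral equation
   says that [x] is absolutely continuous on [0, S], starts at [x0], and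
   satisfies x' = sum_j g^j(x) u_j almost everywhere. *)
Definition is_trajectory g S (x0 : 'cV[R]_n) u x : Prop :=
  forall i : 'I_n,
    mu.-integrable `[0, S] (fun s => (velocity g u x s i 0)%:E) /\
    forall t, t \in `[0, S] ->
      x t i 0 = x0 i 0 + \int[mu]_(s in `[0, t]) velocity g u x s i 0.

(* Trajectories may blow up, so x_u is not defined for every [u]; when the
   g^j are smooth it is unique on [0, S], and quantifying over pairs (u, x)
   amounts to quantifying over the controls [u] for which x_u exists. *)
Definition admissible g S (x0 : 'cV[R]_n) u x : Prop :=
  L2_control S u /\ is_trajectory g S x0 u x.

(* Points reached from [x0] in any finite time. *)
Definition attainable g (x0 : 'cV[R]_n) : set 'cV[R]_n :=
  [set y | exists S u x, [/\ 0 <= S, admissible g S x0 u x & x S = y]].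

Definition cost P T x : \bar R :=
  (\int[mu]_(t in `[0%R, T]) (qform P (x t))%:E)%E.

Definition inf_cost g P T (x0 xT : 'cV[R]_n) : \bar R :=
  ereal_inf [set c | exists u x,
    [/\ admissible g T x0 u x, x T = xT & c = cost P T x]].

Definition near_optimal g P T (x0 xT : 'cV[R]_n) eps : set (R -> 'cV[R]_r) :=
  [set u | exists x, [/\ admissible g T x0 u x,
    (cost P T x <= inf_cost g P T x0 xT + eps%:E)%E &
    enorm (x T - xT) < eps]].

Definition singularity_degree g P T (x0 xT : 'cV[R]_n) : \bar R :=
  limf_esup
    (fun eps : R =>
       ereal_inf [set lne (L2norm T u) | u in near_optimal g P T x0 xT eps]
         / (ln (1 / eps))%:E)%E
    0^'+.

Definition alpha g P (x0 : 'cV[R]_n) : \bar R :=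
  ereal_inf [set (qform P y)%:E | y in attainable g x0].

End ControlSystem.

(* Main.v *)
From HB Require Import structures.
Require Import Defs.
From mathcomp Require Import measurable_realfun ring lra.

(* Upper bounds. Since the system is driftless, trajectories may be run
   backwards and at any speed: running one c times faster multiplies the squared
   L2 norm of the control by c and divides its cost by c. If y is attainable
   from x0, go to y, rest there, come back to x0 and go to xT, all motions taking
   a total time d. The cost is T y'Py + O(d) and the squared norm is O(1/d).
   Letting y approach the infimum alpha gives i); if alpha is attained at y,
   taking d of order eps gives a control of norm O(eps^(-1/2)), hence iii).

   Lower bounds. Every point of a trajectory is attainable, so the cost is at
   least alpha T. If x0'Px0 > alpha, a trajectory of cost at most alpha T + eps
   has to leave a fixed neighborhood of x0 within a time of order eps, so its
   control has a squared norm of order at least 1/eps. If xT'PxT > alpha, apply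
   this to the reversed trajectory. This gives ii). *)

Set Implicit Arguments.
Unset Strict Implicit.
Unset Printing Implicit Defensive.

Local Open Scope classical_set_scope.
Local Open Scope ring_scope.

(** * Affine changes of variables *)

Section AffineChange.
Context {R : realType}.
Local Notation mu := (@lebesgue_measure R).
Implicit Types (k b : R) (D : set R).

Definition affine k b : R -> R := fun t => k * t + b.

Lemma measurable_affine k b D : measurable_fun D (affine k b).
Proof. by apply: measurable_funD => //; exact: measurable_funM. Qed.

Let affT k b : R -> measurableTypeR R := affine k b.

Let push k b : set (measurableTypeR R) -> \bar R := pushforward mu (affT k b).

Let push0 k b : push k b set0 = 0%E.
Proof. by rewrite /push measure0//; exact: measurable_affine. Qed.

Let push_ge0 k b A : (0 <= push k b A)%E.
Proof. by rewrite /push measure_ge0//; exact: measurable_affine. Qed.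

Let push_sigma_additive k b : semi_sigma_additive (push k b).
Proof. by apply: measure_semi_sigma_additive; exact: measurable_affine. Qed.

HB.instance Definition _ k b := isMeasure.Build _ _ _ (push k b)
  (push0 k b) (@push_ge0 k b) (@push_sigma_additive k b).

(** Preimages under [affine k b] are [|k|] times shorter, so the factor [|k|] turns the pushforward
    of the Lebesgue measure back into that measure when [k != 0]. *)
Let pushm k b : {measure set (measurableTypeR R) -> \bar R} :=
  mscale `|k|%:nng (push k b).

Lemma preimage_affine_oc_gt0 k b x y : 0 < k ->
  affine k b @^-1` `]x, y] = `](x - b) / k, (y - b) / k]%classic.
Proof.
move=> k0; apply/seteqP; split => t /=; rewrite !in_itv/= /affine.
  by rewrite ltr_pdivrMr// ler_pdivlMr// ltrBlDr lerBrDr mulrC.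
by rewrite ltr_pdivrMr// ler_pdivlMr// ltrBlDr lerBrDr mulrC.
Qed.

Lemma preimage_affine_oc_lt0 k b x y : k < 0 ->
  affine k b @^-1` `]x, y] = `[(y - b) / k, (x - b) / k[%classic.
Proof.
move=> k0; apply/seteqP; split => t /=; rewrite !in_itv/= /affine.
  by rewrite ltr_ndivlMr// ler_ndivrMr// ltrBlDr lerBrDr mulrC andbC.
by rewrite ltr_ndivlMr// ler_ndivrMr// ltrBlDr lerBrDr mulrC andbC.
Qed.

(** By uniqueness of the Lebesgue measure it suffices to compare both measures on half-open
    intervals. The sign of [k] decides which end of the preimage is closed, which does not affect
    its length. *)
Lemma lebesgue_measure_affine k b : k != 0 ->
  forall A, measurable A -> mu A = pushm k b A.
Proof.
move=> k0; apply: lebesgue_measure_unique => _ [[x y]] _ <-.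
transitivity (`|k|%:E * mu (affine k b @^-1` `]x, y]))%E; last by [].
have [kn|kp|] := ltgtP k 0; last by move/eqP; rewrite (negbTE k0).
- rewrite preimage_affine_oc_lt0// !lebesgue_measure_itv/= !lte_fin.
  rewrite ltr_nM2r ?invr_lt0// ltrD2r; case: ifPn => _; last by rewrite mule0.
  rewrite -!EFinB -EFinM; congr EFin; rewrite ltr0_norm//; field.
  by rewrite lt_eqF.
- rewrite preimage_affine_oc_gt0// !lebesgue_measure_itv/= !lte_fin.
  rewrite ltr_pM2r ?invr_gt0// ltrD2r; case: ifPn => _; last by rewrite mule0.
  rewrite -!EFinB -EFinM; congr EFin; rewrite gtr0_norm//; field.
  by rewrite gt_eqF.
Qed.

Lemma ge0_integral_affine k b D (f : R -> \bar R) : k != 0 -> measurable D ->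
  measurable_fun D f -> (forall x, D x -> (0 <= f x)%E) ->
  (\int[mu]_(x in D) f x =
   `|k|%:E * \int[mu]_(t in affine k b @^-1` D) f (affine k b t))%E.
Proof.
move=> k0 mD mf f0.
rewrite (eq_measure_integral (pushm k b)) => [|A mA _]; last first.
  exact: lebesgue_measure_affine.
rewrite /pushm ge0_integral_mscale//=; congr (_ * _)%E.
rewrite ge0_integral_pushforward//; first exact: measurable_affine.
by move=> x; rewrite inE; exact: f0.
Qed.

Lemma measurable_preimage_affine k b D :
  measurable D -> measurable (affine k b @^-1` D).
Proof. by move=> mD; rewrite -[X in measurable X]setTI; exact: measurable_affine. Qed.

Lemma measurable_fun_affine k b D d (T : measurableType d) (f : R -> T) :
  measurable D -> measurable_fun D f ->
  measurable_fun (affine k b @^-1` D) (f \o affine k b).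
Proof.
move=> mD mf; apply: (measurable_comp mD _ mf); last exact: measurable_affine.
by move=> _ [t Dt <-].
Qed.

Lemma integrable_affine k b D (f : R -> \bar R) : k != 0 -> measurable D ->
  mu.-integrable D f -> mu.-integrable (affine k b @^-1` D) (f \o affine k b).
Proof.
move=> k0 mD /integrableP[mf fy]; apply/integrableP; split.
  exact: measurable_fun_affine.
move: fy; rewrite (ge0_integral_affine (k := k) b)//; last exact: measurableT_comp.
(* By contraposition: an infinite integral over the preimage stays infinite after multiplication by
   [|k| > 0]. *)
move=> h; rewrite ltey; apply: contraL h => /eqP h.
by rewrite [X in (_ * X)%E]h mulry gtr0_sg ?normr_gt0// mul1e ltxx.
Qed.

(** The nonnegative case is applied to the positive and negative parts. Integrability allows [|k|]
    to be pulled out of their difference and out of [fine]. *)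
Lemma Rintegral_affine k b D (f : R -> R) : k != 0 -> measurable D ->
  mu.-integrable D (EFin \o f) ->
  \int[mu]_(x in D) f x =
  `|k| * \int[mu]_(t in affine k b @^-1` D) f (affine k b t).
Proof.
move=> k0 mD intf.
have mD' := measurable_preimage_affine k b mD.
have intf' := integrable_affine b k0 mD intf.
rewrite /Rintegral -[X in X * _]/(fine `|k|%:E) -fineM//; last first.
  exact: integrable_fin_num intf'.
congr fine.
have mf : measurable_fun D (EFin \o f) by exact: (measurable_int mu).
have pos := ge0_integral_affine b k0 mD (measurable_funepos mf)
  (fun x _ => funepos_ge0 (EFin \o f) x).
have neg := ge0_integral_affine b k0 mD (measurable_funeneg mf)
  (fun x _ => funeneg_ge0 (EFin \o f) x).
rewrite [LHS]integralE pos neg -muleBr//; last first.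
  have := @integrable_add_def _ _ R mu _ mD' _ intf'.
  by rewrite funepos_comp funeneg_comp.
rewrite -[RHS]/(`|k|%:E *
  \int[mu]_(t in affine k b @^-1` D) ((EFin \o f) \o affine k b) t)%E.
by rewrite [X in _ = (_ * X)%E]integralE (funepos_comp (EFin \o f) (affine k b))
  (funeneg_comp (EFin \o f) (affine k b)).
Qed.

End AffineChange.

(** * Accelerating, reversing and concatenating functions of time *)

Section TimeChange.
Context {R : realType}.
Local Notation mu := (@lebesgue_measure R).
Implicit Types (c S t : R) (f : R -> R).

Lemma preimage_scale c t : 0 < c -> affine c 0 @^-1` `[0, c * t] = `[0, t]%classic.
Proof.
move=> c0; apply/seteqP; split => s /=; rewrite /affine !in_itv/= addr0.
  by rewrite pmulr_rge0// ler_pM2l.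
by rewrite pmulr_rge0// ler_pM2l.
Qed.

Lemma preimage_reverse S t : affine (-1) S @^-1` `[S - t, S] = `[0, t]%classic.
Proof.
apply/seteqP; split => s /=; rewrite /affine !in_itv/= => /andP[s1 s2].
  by apply/andP; split; lra.
by apply/andP; split; lra.
Qed.

Lemma preimage_shift S t : affine 1 (- S) @^-1` `]0, t] = `]S, S + t]%classic.
Proof.
apply/seteqP; split => s /=; rewrite /affine !in_itv/= => /andP[s1 s2].
  by apply/andP; split; lra.
by apply/andP; split; lra.
Qed.

Lemma comp_scale c (T : Type) (f : R -> T) : (fun s => f (c * s)) = f \o affine c 0.
Proof. by apply/funext => s; rewrite /= /affine addr0. Qed.

Lemma comp_reverse S (T : Type) (f : R -> T) :
  (fun s => f (S - s)) = f \o affine (-1) S.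
Proof. by apply/funext => s; rewrite /= /affine mulN1r addrC. Qed.

Lemma comp_shift S (T : Type) (f : R -> T) :
  (fun s => f (s - S)) = f \o affine 1 (- S).
Proof. by apply/funext => s; rewrite /= /affine mul1r. Qed.

Lemma measurable_fun_scale c t f : 0 < c -> measurable_fun `[0, c * t] f ->
  measurable_fun `[0, t] (fun s => f (c * s)).
Proof.
move=> c0 mf; rewrite comp_scale -(preimage_scale t c0).
by apply: measurable_fun_affine.
Qed.

Lemma integrable_scale c t f : 0 < c -> mu.-integrable `[0, c * t] (EFin \o f) ->
  mu.-integrable `[0, t] (EFin \o (fun s => f (c * s))).
Proof.
move=> c0 intf; rewrite comp_scale -(preimage_scale t c0).
have k0 : c != 0 by rewrite gt_eqF.
exact: (integrable_affine 0 k0 _ intf).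
Qed.

Lemma Rintegral_scale c t f : 0 < c -> mu.-integrable `[0, c * t] (EFin \o f) ->
  \int[mu]_(s in `[0, c * t]) f s = c * \int[mu]_(s in `[0, t]) f (c * s).
Proof.
move=> c0 intf; rewrite comp_scale -(preimage_scale t c0).
by rewrite (Rintegral_affine (k := c) 0)// ?gt_eqF// gtr0_norm.
Qed.

Lemma measurable_fun_reverse S f : measurable_fun `[0, S] f ->
  measurable_fun `[0, S] (fun s => f (S - s)).
Proof.
move=> mf; rewrite comp_reverse -(preimage_reverse S S) subrr.
by apply: measurable_fun_affine.
Qed.

Lemma integrable_reverse S f : mu.-integrable `[0, S] (EFin \o f) ->
  mu.-integrable `[0, S] (EFin \o (fun s => f (S - s))).
Proof.
move=> intf; rewrite comp_reverse -(preimage_reverse S S) subrr.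
have k0 : -1 != 0 :> R by rewrite oppr_eq0 oner_eq0.
exact: (integrable_affine S k0 _ intf).
Qed.

Lemma integrable_itv0S S t (f : R -> \bar R) : t <= S ->
  mu.-integrable `[0, S] f -> mu.-integrable `[0, t] f.
Proof.
move=> tS; apply: integrableS => //.
by apply: subset_itvl; rewrite bnd_simp.
Qed.

(** The reflection s -> S - s carries [0, t] to [S - t, S]. The result is written with integrals
    starting at 0, the form in which the integral equation of a trajectory supplies them. *)
Lemma Rintegral_reverse S t f : 0 <= t <= S -> mu.-integrable `[0, S] (EFin \o f) ->
  \int[mu]_(s in `[0, t]) f (S - s) =
  \int[mu]_(s in `[0, S]) f s - \int[mu]_(s in `[0, S - t]) f s.
Proof.
move=> /andP[t0 tS] intf; rewrite Rintegral_itvB//; last 2 first.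
  by rewrite bnd_simp subr_ge0.
  by rewrite bnd_simp lerBlDr lerDl.
have intf' : mu.-integrable `]S - t, S] (EFin \o f).
  by apply: integrableS intf => //; apply: subset_itvr; rewrite bnd_simp subr_ge0.
have intf2 : mu.-integrable `[S - t, S] (EFin \o f).
  by apply: integrableS intf => //; apply: subset_itvr; rewrite bnd_simp subr_ge0.
rewrite Rintegral_itv_obnd_cbnd// comp_reverse -(preimage_reverse S t).
rewrite [RHS](Rintegral_affine (k := -1) S)//.
by rewrite normrN1 mul1r.
Qed.

(** At the junction time [S] the first piece prevails, so the second one occupies the half-open
    interval ]S, S + S']. *)
Definition concat {A : Type} S (f1 f2 : R -> A) : R -> A :=
  fun t => if t <= S then f1 t else f2 (t - S).

Lemma concat_comp {A B : Type} (h : A -> B) S (f1 f2 : R -> A) t :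
  h (concat S f1 f2 t) = concat S (h \o f1) (h \o f2) t.
Proof. by rewrite /concat; case: ifP. Qed.

Lemma in_concatl {A : Type} S t (f1 f2 : R -> A) : t <= S ->
  {in `[0, t]%classic, f1 =1 concat S f1 f2}.
Proof.
move=> tS s; rewrite inE/= in_itv/= => /andP[_ st].
by rewrite /concat (le_trans st).
Qed.

Lemma in_concatr {A : Type} S t (f1 f2 : R -> A) :
  {in `]S, t]%classic, (fun s => f2 (s - S)) =1 concat S f1 f2}.
Proof.
move=> s; rewrite inE/= in_itv/= => /andP[Ss _].
by rewrite /concat leNgt Ss.
Qed.

Lemma setU_itv0 S S' : 0 <= S -> 0 <= S' ->
  `[0, S + S']%classic = `[0, S]%classic `|` `]S, S + S']%classic.
Proof.
move=> S0 S'0; apply: itv_bndbnd_setU; rewrite bnd_simp//.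
by rewrite lerDl.
Qed.

Lemma measurable_concat S S' (f1 f2 : R -> R) : 0 <= S -> 0 <= S' ->
  measurable_fun `[0, S] f1 -> measurable_fun `[0, S'] f2 ->
  measurable_fun `[0, S + S'] (concat S f1 f2).
Proof.
move=> S0 S'0 m1 m2; rewrite setU_itv0//; apply/measurable_funU => //; split.
  by apply: eq_measurable_fun m1; exact: in_concatl.
apply: eq_measurable_fun (in_concatr f1 f2) _.
rewrite comp_shift -preimage_shift; apply: measurable_fun_affine => //.
by apply: measurable_funS m2 => //; apply: subset_itvr; rewrite bnd_simp.
Qed.

Lemma integrable_concatr S t (f1 f2 : R -> R) :
  mu.-integrable `[0, t] (EFin \o f2) ->
  mu.-integrable `]S, S + t] (EFin \o concat S f1 f2).
Proof.
move=> i2; have : mu.-integrable `]S, S + t] (EFin \o (fun s => f2 (s - S))).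
  rewrite comp_shift -preimage_shift.
  apply: (integrable_affine (- S) (oner_neq0 R) _
    (_ : mu.-integrable _ (EFin \o f2))) => //.
  by apply: integrableS i2 => //; apply: subset_itvr; rewrite bnd_simp.
by apply: eq_integrable => // s /in_concatr => /(_ _ f1 f2)/= ->.
Qed.

Lemma integrable_concatl S t (f1 f2 : R -> R) : t <= S ->
  mu.-integrable `[0, S] (EFin \o f1) ->
  mu.-integrable `[0, t] (EFin \o concat S f1 f2).
Proof.
move=> tS /(integrable_itv0S tS); apply: eq_integrable => //.
by move=> s /(in_concatl f1 f2 tS)/= ->.
Qed.

Lemma integrable_concat S S' (f1 f2 : R -> R) : 0 <= S -> 0 <= S' ->
  mu.-integrable `[0, S] (EFin \o f1) -> mu.-integrable `[0, S'] (EFin \o f2) ->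
  mu.-integrable `[0, S + S'] (EFin \o concat S f1 f2).
Proof.
move=> S0 S'0 i1 i2.
have := integrable_concatl f2 (lexx S) i1; have := integrable_concatr S f1 i2.
move=> /integrableP[mr fr] /integrableP[ml fl].
have m : measurable_fun `[0, S + S'] (EFin \o concat S f1 f2).
  by rewrite setU_itv0//; apply/measurable_funU.
apply/integrableP; split => //.
rewrite setU_itv0// ge0_integral_setU//=.
- by rewrite lte_add_pinfty.
- rewrite -setU_itv0// -[X in measurable_fun _ X]/(abse \o (EFin \o concat S f1 f2)).
  exact: measurableT_comp.
- apply/disj_setPS => s /= []; rewrite !in_itv/= => /andP[_ sS] /andP[Ss _].
  by move: (lt_le_trans Ss sS); rewrite ltxx.
Qed.

Lemma Rintegral_concatl S t (f1 f2 : R -> R) : t <= S ->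
  \int[mu]_(s in `[0, t]) concat S f1 f2 s = \int[mu]_(s in `[0, t]) f1 s.
Proof. by move=> tS; apply: eq_Rintegral => s /(in_concatl f1 f2 tS). Qed.

(** The integrals of the concatenation up to [S + t] and up to [S] differ by its integral over ]S, S
    + t], which a shift brings back to [f2] on ]0, t]. *)
Lemma Rintegral_concat S t (f1 f2 : R -> R) : 0 <= S -> 0 <= t ->
  mu.-integrable `[0, S] (EFin \o f1) -> mu.-integrable `[0, t] (EFin \o f2) ->
  \int[mu]_(s in `[0, S + t]) concat S f1 f2 s =
  \int[mu]_(s in `[0, S]) f1 s + \int[mu]_(s in `[0, t]) f2 s.
Proof.
move=> S0 t0 i1 i2; rewrite [RHS]addrC; apply/eqP.
rewrite -subr_eq -(Rintegral_concatl f1 f2 (lexx S)).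
rewrite Rintegral_itvB; last 3 first.
  exact: integrable_concat.
  by rewrite bnd_simp.
  by rewrite bnd_simp lerDl.
rewrite -(eq_Rintegral mu (in_concatr f1 f2)) comp_shift -preimage_shift.
have i2' : mu.-integrable `]0, t] (EFin \o f2).
  by apply: integrableS i2 => //; apply: subset_itvr; rewrite bnd_simp.
rewrite -Rintegral_itv_obnd_cbnd//.
by rewrite [X in _ == X](Rintegral_affine (k := 1) (- S))// normr1 mul1r.
Qed.

End TimeChange.

(** * Energy of controls and trajectories *)

Section Energy.
Context {R : realType} {r : nat}.
Local Notation mu := (@lebesgue_measure R).
Implicit Types (S : R) (u : R -> 'cV[R]_r).

(** The squared L2 norm as a real number, meaningful when [u] is an L2 control. Unlike the norm, it
    is additive under concatenation. *)
Definition energy S u : R := \int[mu]_(t in `[0, S]) \sum_j u t j 0 ^+ 2.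

Lemma poweR2_abse (y : R) : (`|y%:E| `^ 2 = (y ^+ 2)%:E)%E.
Proof. by rewrite abse_EFin poweR_EFin powR_mulrn// real_normK// num_real. Qed.

Lemma sqr_patch (f : R -> R) (D : set R) :
  (fun t => (f \_ D) t ^+ 2) = (fun t => f t ^+ 2) \_ D.
Proof. by apply/funext => t; rewrite !patchE; case: ifP => // _; rewrite expr0n. Qed.

(** Membership in [Lfun] concerns functions extended by zero to the whole line; this form on
    [[0, S]] is the one to which time changes and concatenations apply. *)
Lemma L2_controlP S u : L2_control S u <-> forall j : 'I_r,
  measurable_fun `[0, S] (fun t => u t j 0) /\
  mu.-integrable `[0, S] (EFin \o (fun t => u t j 0 ^+ 2)).
Proof.
split => h j.
  have := h j => hj; split.
    apply/measurable_restrictT => //.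
    by move: hj => /sub_Lfun_mfun; rewrite inE.
  have := Lfun2_integrable_sqr hj; rewrite sqr_patch -restrict_EFin.
  by move=> h'; apply/integrable_mkcond.
have [mu2 iu2] := h j; rewrite inE; apply/andP; split; rewrite inE/=.
  have mI : measurable (`[0, S] : set (measurableTypeR R)) by [].
  exact: ((measurable_restrictT (fun t : measurableTypeR R => u t j 0) mI).1 mu2).
rewrite /finite_norm unlock; apply: poweR_lty.
have : mu.-integrable setT
    (EFin \o (fun t => (((fun t => u t j 0) \_ `[0, S]) t ^+ 2))).
  by rewrite sqr_patch -restrict_EFin; apply/integrable_restrict => //; rewrite setTI.
move=> iq; apply: le_lt_trans (integrable_lty measurableT iq).
rewrite le_eqVlt; apply/orP; left; apply/eqP; apply: eq_integral => t _.
exact: poweR2_abse.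
Qed.

Lemma L2_control_integrable S u : L2_control S u ->
  mu.-integrable `[0, S] (EFin \o (fun t => \sum_j u t j 0 ^+ 2)).
Proof.
move=> /L2_controlP h.
have -> : EFin \o (fun t => \sum_j u t j 0 ^+ 2) =
    (fun t => (\sum_j (u t j 0 ^+ 2)%:E)%E).
  by apply/funext => t /=; rewrite sumEFin.
by apply: integrable_sum => // j _; exact: (h j).2.
Qed.

Lemma energy_ge0 S u : 0 <= energy S u.
Proof. by apply: Rintegral_ge0 => t _; apply: sumr_ge0 => j _; exact: sqr_ge0. Qed.

Lemma enormK n (v : 'cV[R]_n) : enorm v ^+ 2 = \sum_i v i 0 ^+ 2.
Proof. by rewrite sqr_sqrtr// sumr_ge0// => i _; exact: sqr_ge0. Qed.

Lemma L2normE S u : L2_control S u -> L2norm S u = (Num.sqrt (energy S u))%:E.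
Proof.
move=> hu; rewrite /L2norm unlock.
transitivity ((energy S u)%:E `^ 2^-1)%E; last first.
  by rewrite poweR_EFin powR12_sqrt// energy_ge0.
congr (poweR _ _); rewrite /energy /Rintegral fineK; last first.
  by apply: integrable_fin_num => //; exact: L2_control_integrable.
rewrite [RHS]integral_mkcond; apply: eq_integral => t _.
etransitivity; first exact: poweR2_abse.
by rewrite !patchE; case: ifP => _; rewrite ?enormK// expr0n.
Qed.

End Energy.

(** * Trajectories: continuity, change of speed, reversal, concatenation, rest *)

Section Trajectories.
Context {R : realType} {n r : nat}.
Local Notation mu := (@lebesgue_measure R).
Implicit Types (g : 'I_r -> 'cV[R]_n -> 'cV[R]_n) (P : 'M[R]_n).
Implicit Types (u : R -> 'cV[R]_r) (x : R -> 'cV[R]_n) (S : R) (p : 'cV[R]_n).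

Lemma trajectory0 g S p u x : 0 <= S -> is_trajectory g S p u x -> x 0 = p.
Proof.
move=> S0 h; apply/matrixP => i j; rewrite ord1.
have [_ ->] := h i; last by rewrite in_itv/= lexx.
by rewrite set_itv1 Rintegral_set1 addr0.
Qed.

(** On [0, S] each coordinate is a constant plus the indefinite integral of an integrable
    velocity. *)
Lemma trajectory_continuous g S p u x i : 0 <= S -> is_trajectory g S p u x ->
  {within `[0, S], continuous (fun t => x t i 0)}.
Proof.
move=> S0 /(_ i)[iv xE].
have /= c := parameterized_integral_continuous S0 iv.
have : {within `[0, S], continuous (fun t => p i 0 +
    parameterized_integral mu 0 t (fun s => velocity g u x s i 0))}.
  by move=> t; apply: cvgD; [exact: cvg_cst|exact: c].
apply: subspace_eq_continuous => t; rewrite inE => tS /=.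
by rewrite -[RHS]/(x t i 0) xE.
Qed.

Lemma qformE P (v : 'cV[R]_n) :
  qform P v = \sum_j (\sum_i v i 0 * P i j) * v j 0.
Proof.
rewrite /qform mxE; apply: eq_bigr => j _; congr (_ * _).
by rewrite mxE; apply: eq_bigr => i _; rewrite mxE.
Qed.

(** The arbitrary source space serves two purposes: the subspace [0, S] for trajectories, and the
    identity of the state space for [qform P] itself. *)
Lemma qform_continuous_comp P (T : topologicalType) (x : T -> 'cV[R]_n) :
  (forall i, continuous (fun t => x t i 0)) -> continuous (fun t => qform P (x t)).
Proof.
move=> xc; rewrite (_ : (fun t => _) =
    fun t => \sum_j (\sum_i x t i 0 * P i j) * x t j 0); last first.
  by apply/funext => t; rewrite qformE.
apply: continuous_big => [|j _ t]; first exact: add_continuous.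
apply: cvgM; last exact: xc.
apply: (continuous_big (op := +%R)) => [|i _ s]; first exact: add_continuous.
by apply: cvgMl; exact: xc.
Qed.

Lemma trajectory_qform_integrable g P S p u x : 0 <= S ->
  is_trajectory g S p u x ->
  mu.-integrable `[0, S] (EFin \o (fun t => qform P (x t))).
Proof.
move=> S0 h; apply: continuous_compact_integrable; first exact: segment_compact.
apply: (qform_continuous_comp (T := subspace `[0, S])) => i.
exact: trajectory_continuous h.
Qed.

Lemma admissible_sub g S p u x t : t <= S ->
  admissible g S p u x -> admissible g t p u x.
Proof.
move=> tS [/L2_controlP hu hx]; split.
  apply/L2_controlP => j; have [m i] := hu j; split.
    by apply: measurable_funS m => //; apply: subset_itvl; rewrite bnd_simp.
  exact: integrable_itv0S i.
move=> i; have [iv xE] := hx i; split; first exact: integrable_itv0S iv.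
move=> s; rewrite in_itv/= => /andP[s0 st]; apply: xE.
by rewrite in_itv/= s0 (le_trans st).
Qed.

(** The absence of drift enters here: the velocity is linear in the control, so a path run [c] times
    faster is driven by a control [c] times larger. *)
Lemma velocity_scale g c (u : R -> 'cV[R]_r) x s :
  velocity g (fun t => c *: u (c * t)) (fun t => x (c * t)) s =
  c *: velocity g u x (c * s).
Proof.
by rewrite /velocity scaler_sumr; apply: eq_bigr => j _; rewrite mxE scalerA.
Qed.

Lemma admissible_scale g c S p u x : 0 < c -> admissible g (c * S) p u x ->
  admissible g S p (fun t => c *: u (c * t)) (fun t => x (c * t)).
Proof.
move=> c0 [/L2_controlP hu hx]; split.
  apply/L2_controlP => j; have [m i] := hu j; split.
    rewrite (_ : (fun t => _) = (fun t => c * u (c * t) j 0)); last first.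
      by apply/funext => t; rewrite mxE.
    by apply: measurable_funM => //; exact: measurable_fun_scale m.
  rewrite (_ : EFin \o _ = fun t => ((c ^+ 2)%:E * (u (c * t) j 0 ^+ 2)%:E)%E).
    by apply: integrableZl => //; exact: integrable_scale i.
  by apply/funext => t; rewrite /= mxE exprMn EFinM.
move=> i; have [iv xE] := hx i; split.
  rewrite (_ : (fun s => _) = fun s => (c%:E * (velocity g u x (c * s) i 0)%:E)%E).
    by apply: integrableZl => //; exact: integrable_scale iv.
  by apply/funext => s; rewrite velocity_scale mxE EFinM.
move=> t; rewrite in_itv/= => /andP[t0 tS].
have ct : c * t \in `[0, c * S] by rewrite in_itv/= pmulr_rge0// t0/= ler_pM2l.
have iv' : mu.-integrable `[0, c * t] (EFin \o (fun s => velocity g u x s i 0)).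
  by apply: integrable_itv0S iv; rewrite ler_pM2l.
rewrite xE// Rintegral_scale// -RintegralZl//; last exact: integrable_scale iv'.
by congr (_ + _); apply: eq_Rintegral => s _; rewrite velocity_scale mxE.
Qed.

(** Squaring the control gives [c ^+ 2], and the shorter duration takes back one factor [c]. *)
Lemma energy_scale c S u : 0 < c -> L2_control (c * S) u ->
  energy S (fun t => c *: u (c * t)) = c * energy (c * S) u.
Proof.
move=> c0 /L2_control_integrable hu.
rewrite /energy Rintegral_scale// mulrA -RintegralZl//; last first.
  exact: integrable_scale hu.
apply: eq_Rintegral => t _; rewrite mulr_sumr; apply: eq_bigr => j _.
by rewrite mxE exprMn expr2.
Qed.

Lemma velocity_reverse g S u x s :
  velocity g (fun t => - u (S - t)) (fun t => x (S - t)) s =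
  - velocity g u x (S - s).
Proof.
rewrite /velocity raddf_sum/=; apply: eq_bigr => j _.
by rewrite mxE scaleNr.
Qed.

Lemma admissible_reverse g S p u x : 0 <= S -> admissible g S p u x ->
  admissible g S (x S) (fun t => - u (S - t)) (fun t => x (S - t)).
Proof.
move=> S0 [/L2_controlP hu hx]; split.
  apply/L2_controlP => j; have [m i] := hu j; split.
    rewrite (_ : (fun t => _) = \- (fun t => u (S - t) j 0)); last first.
      by apply/funext => t; rewrite mxE.
    by apply: measurable_funN; exact: measurable_fun_reverse m.
  rewrite (_ : EFin \o _ = EFin \o fun t => u (S - t) j 0 ^+ 2).
    exact: integrable_reverse i.
  by apply/funext => t; rewrite /= mxE sqrrN.
move=> i; have [iv xE] := hx i; split.
  rewrite (_ : (fun s => _) = -%E \o (EFin \o fun s => velocity g u x (S - s) i 0)).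
    by apply: integrableN => //; exact: integrable_reverse iv.
  by apply/funext => s; rewrite velocity_reverse mxE EFinN.
move=> t; rewrite in_itv/= => /andP[t0 tS].
have tS' : S - t \in `[0, S] by rewrite in_itv/= subr_ge0 tS/= lerBlDr lerDl.
have SS : S \in `[0, S] by rewrite in_itv/= S0 lexx.
have -> : \int[mu]_(s in `[0, t])
    velocity g (fun t => - u (S - t)) (fun t => x (S - t)) s i 0 =
    - \int[mu]_(s in `[0, t]) velocity g u x (S - s) i 0.
  rewrite -mulN1r -RintegralZl//; last first.
    exact: integrable_itv0S tS (integrable_reverse iv).
  by apply: eq_Rintegral => s _; rewrite velocity_reverse mxE mulN1r.
rewrite (Rintegral_reverse _ iv) ?t0//.
(* The integral equation at [S - t] and at [S]: the two points differ by the integral of the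
   velocity over [S - t, S]. *)
by rewrite (xE _ tS') (xE _ SS); ring.
Qed.

Lemma energy_reverse S u : 0 <= S -> L2_control S u ->
  energy S (fun t => - u (S - t)) = energy S u.
Proof.
move=> S0 /L2_control_integrable hu.
rewrite /energy.
have := @Rintegral_reverse _ S S _ _ hu; rewrite S0 lexx subrr set_itv1.
rewrite Rintegral_set1 subr0 => /(_ isT) <-.
apply: eq_Rintegral => t _; apply: eq_bigr => j _.
by rewrite mxE sqrrN.
Qed.

Lemma admissible_concat g S1 S2 p u1 x1 u2 x2 : 0 <= S1 -> 0 <= S2 ->
  admissible g S1 p u1 x1 -> admissible g S2 (x1 S1) u2 x2 ->
  admissible g (S1 + S2) p (concat S1 u1 u2) (concat S1 x1 x2).
Proof.
move=> S10 S20 [/L2_controlP hu1 hx1] [/L2_controlP hu2 hx2].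
have vE i : (fun s => velocity g (concat S1 u1 u2) (concat S1 x1 x2) s i 0) =
    concat S1 (fun s => velocity g u1 x1 s i 0) (fun s => velocity g u2 x2 s i 0).
  by apply/funext => s; rewrite /velocity /concat; case: ifP.
split.
  apply/L2_controlP => j; have [m1 i1] := hu1 j; have [m2 i2] := hu2 j; split.
    rewrite (_ : (fun t => _) = concat S1 (fun t => u1 t j 0) (fun t => u2 t j 0)).
      exact: measurable_concat.
    by apply/funext => t; rewrite /concat; case: ifP.
  rewrite (_ : (fun t => _) =
    concat S1 (fun t => u1 t j 0 ^+ 2) (fun t => u2 t j 0 ^+ 2)).
    exact: integrable_concat.
  by apply/funext => t; rewrite /concat; case: ifP.
move=> i; have [iv1 x1E] := hx1 i; have [iv2 x2E] := hx2 i.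
rewrite (_ : (fun s => _%:E) = EFin \o concat S1 (fun s => velocity g u1 x1 s i 0)
  (fun s => velocity g u2 x2 s i 0)); last by rewrite -vE.
split; first exact: integrable_concat.
move=> t; rewrite in_itv/= => /andP[t0 tS]; rewrite vE.
have [tS1|S1t] := leP t S1.
  rewrite Rintegral_concatl// /concat tS1; apply: x1E.
  by rewrite in_itv/= t0.
have tS2 : t - S1 \in `[0, S2] by rewrite in_itv/=; apply/andP; split; lra.
have SS : S1 \in `[0, S1] by rewrite in_itv/= S10 lexx.
(* Past the junction, the integral over [0, S1] rebuilds [x1 S1], the starting point of the second
   piece. *)
rewrite -(subrK S1 t) (addrC _ S1) Rintegral_concat//; last 2 first.
  by rewrite subr_ge0 ltW.
  by apply: integrable_itv0S iv2; lra.
rewrite /concat [S1 + _]addrC subrK leNgt S1t/= (x2E _ tS2) (x1E _ SS).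
by rewrite addrA.
Qed.

Lemma energy_concat S1 S2 u1 u2 : 0 <= S1 -> 0 <= S2 ->
  L2_control S1 u1 -> L2_control S2 u2 ->
  energy (S1 + S2) (concat S1 u1 u2) = energy S1 u1 + energy S2 u2.
Proof.
move=> S10 S20 /L2_control_integrable h1 /L2_control_integrable h2.
rewrite /energy -Rintegral_concat//; apply: eq_Rintegral => t _.
exact: (concat_comp (fun v : 'cV[R]_r => \sum_j v j 0 ^+ 2)).
Qed.

(** Without drift, the zero control keeps the state at rest. *)
Lemma admissible_cst g S p : admissible g S p (cst 0) (cst p).
Proof.
split.
  apply/L2_controlP => j; split.
    by rewrite (_ : (fun t => _) = cst 0)//; apply/funext => t; rewrite mxE.
  rewrite (_ : (fun t => _) = cst 0); first exact: integrable0.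
  by apply/funext => t; rewrite mxE expr0n.
have v0 i : (fun s => velocity g (cst 0) (cst p) s i 0) = cst 0.
  apply/funext => s; rewrite /velocity big1 ?mxE// => j _.
  by rewrite mxE scale0r.
move=> i; split.
  rewrite (_ : (fun s => _%:E) = EFin \o cst 0); last by rewrite -(v0 i).
  exact: integrable0.
by move=> t tS; rewrite v0 Rintegral_cst// mul0r addr0.
Qed.

Lemma energy_cst0 S : energy S (cst 0 : R -> 'cV[R]_r) = 0.
Proof.
rewrite /energy (_ : (fun t => _) = cst 0) ?Rintegral_cst ?mul0r//.
by apply/funext => t; rewrite big1// => j _; rewrite mxE expr0n.
Qed.

End Trajectories.

(** * Reachability with bounded energy and cost *)

Section Reach.
Context {R : realType} {n r : nat}.
Local Notation mu := (@lebesgue_measure R).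
Variables (g : 'I_r -> 'cV[R]_n -> 'cV[R]_n) (P : 'M[R]_n).
Implicit Types (u : R -> 'cV[R]_r) (x : R -> 'cV[R]_n) (S E K : R).
Implicit Types (p q y : 'cV[R]_n).

(** The duration [S] is exact, while [E] and [K] are only upper bounds on energy and cost; all three
    add up under concatenation. *)
Definition reach p q S E K : Prop := exists u x,
  [/\ admissible g S p u x, x S = q, energy S u <= E &
      \int[mu]_(t in `[0, S]) qform P (x t) <= K].

Lemma attainable_reach p q : attainable g p q ->
  exists S E K, [/\ 0 <= S, 0 <= E & reach p q S E K].
Proof.
move=> [S [u [x [S0 adm xS]]]].
exists S, (energy S u), (\int[mu]_(t in `[0, S]) qform P (x t)).
by split; [|exact: energy_ge0|exists u, x].
Qed.

Lemma reach_cst p S : 0 <= S -> reach p p S 0 (S * qform P p).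
Proof.
move=> S0; exists (cst 0), (cst p); split => //.
- exact: admissible_cst.
- by rewrite energy_cst0.
- rewrite [leLHS](_ : _ = \int[mu]_(_ in `[0, S]) qform P p)//.
  rewrite Rintegral_cst//= lebesgue_measure_itv/= lte_fin mulrC.
  by move: S0; rewrite le_eqVlt => /predU1P[<-|->]; rewrite ?ltxx ?mul0r//= subr0.
Qed.

Lemma reach_reverse p q S E K : 0 <= S -> reach p q S E K -> reach q p S E K.
Proof.
move=> S0 [u [x [adm <- uE xK]]]; have [hu hx] := adm.
exists (fun t => - u (S - t)), (fun t => x (S - t)); split.
- exact: (admissible_reverse S0 adm).
- by rewrite subrr; exact: trajectory0 hx.
- by rewrite energy_reverse.
- have iq := trajectory_qform_integrable P S0 hx.
  have := @Rintegral_reverse _ S S _ _ iq; rewrite S0 lexx subrr set_itv1.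
  by rewrite Rintegral_set1 subr0 => /(_ isT) ->.
Qed.

Lemma reach_scale c p q S E K : 0 < c -> 0 <= S -> reach p q S E K ->
  reach p q (S / c) (c * E) (K / c).
Proof.
move=> c0 S0 [u [x [adm <- uE xK]]]; have [hu hx] := adm.
have cS : c * (S / c) = S by rewrite mulrCA divff ?mulr1// gt_eqF.
exists (fun t => c *: u (c * t)), (fun t => x (c * t)); split.
- by apply: admissible_scale => //; rewrite cS.
- by rewrite cS.
- by rewrite energy_scale ?cS// ler_pM2l.
- rewrite ler_pdivlMr// mulrC -[leLHS]/(c * \int[mu]_(t in `[0, S / c])
    (fun s => qform P (x s)) (c * t)).
  rewrite -Rintegral_scale ?cS//.
  exact: trajectory_qform_integrable hx.
Qed.

Lemma reach_concat p q y S1 S2 E1 E2 K1 K2 : 0 <= S1 -> 0 <= S2 ->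
  reach p q S1 E1 K1 -> reach q y S2 E2 K2 ->
  reach p y (S1 + S2) (E1 + E2) (K1 + K2).
Proof.
move=> S10 S20 [u1 [x1 [adm1 xq uE1 xK1]]] [u2 [x2 [adm2 <- uE2 xK2]]].
have [hu1 hx1] := adm1; have [hu2 hx2] := adm2.
exists (concat S1 u1 u2), (concat S1 x1 x2); split.
- by apply: admissible_concat; rewrite ?xq.
(* The endpoint falls in the first piece exactly when [S2 = 0]; both pieces then agree there, since
   [x2] starts at [q]. *)
- rewrite /concat; case: leP => [S120|_]; last by rewrite [S1 + S2]addrC addrK.
  have -> : S2 = 0 by lra.
  by rewrite addr0 xq (trajectory0 S20 hx2).
- by rewrite energy_concat// lerD.
- have -> : (fun t => qform P (concat S1 x1 x2 t)) =
      concat S1 (fun t => qform P (x1 t)) (fun t => qform P (x2 t)).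
    by apply/funext => t; exact: concat_comp.
  rewrite Rintegral_concat ?lerD//.
    exact: trajectory_qform_integrable hx1.
  exact: trajectory_qform_integrable hx2.
Qed.

Lemma reach_le p q S E K E' K' : E <= E' -> K <= K' ->
  reach p q S E K -> reach p q S E' K'.
Proof.
move=> EE' KK' [u [x [adm xq uE xK]]]; exists u, x.
by split => //; [exact: le_trans EE'|exact: le_trans KK'].
Qed.

Lemma qform_ge0 y : posdef_sym P -> 0 <= qform P y.
Proof.
move=> [_ pos]; have [->|/pos/ltW//] := eqVneq y 0.
by rewrite qformE big1// => j _; rewrite mxE mulr0.
Qed.

(* Go from p to y and back, then on to q, at a speed of order 1/d, and rest at
   y for the remaining time T - d. *)
Lemma reach_resting p q y T : posdef_sym P -> 0 < T ->
  attainable g p q -> attainable g p y ->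
  exists E K, [/\ 0 < E, 0 < K & forall d, 0 < d < T ->
    reach p q T (E / d) (T * qform P y + K * d)].
Proof.
move=> posP T0 /attainable_reach[S1 [E1 [K1 [S10 E10 r1]]]].
move=> /attainable_reach[S2 [E2 [K2 [S20 E20 r2]]]].
(* Total duration before acceleration: to [y], back to [p], a pause of length 1 at [p], then to [q].
   The pause keeps [S0] positive even if [S1] and [S2] vanish. *)
pose S0 := S2 + (S2 + (1 + S1)); have S00 : 0 < S0 by rewrite /S0; lra.
pose E0 := E2 + (E2 + (0 + E1)).
pose K0 := K2 + (K2 + (1 * qform P p + K1)).
have r3 : reach y q (S2 + (1 + S1)) (E2 + (0 + E1)) (K2 + (1 * qform P p + K1)).
  apply: (reach_concat S20 _ (reach_reverse S20 r2)); first lra.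
  by apply: (reach_concat ler01 S10 _ r1); exact: reach_cst.
(* The speed factor [S0 / d] multiplies [E0] and divides [K0], which gives S0 E0 / d and (K0 / S0)
   d. The absolute value and the added ones make both constants positive. *)
exists (S0 * E0 + 1), (`|K0 / S0| + 1); split.
- by rewrite ltr_wpDl// mulr_ge0 ?(ltW S00)// /E0; lra.
- by rewrite ltr_wpDl.
move=> d /andP[d0 dT]; pose c := S0 / d.
have c0 : 0 < c by rewrite divr_gt0.
have rest := @reach_cst y (T - d) (ltac:(lra)).
have := reach_concat _ _ (reach_scale c0 _ r2)
  (reach_concat _ _ rest (reach_scale c0 _ r3)).
have S30 : 0 <= S2 + (1 + S1) by lra.
have S2c : 0 <= S2 / c by rewrite divr_ge0// ltW.
have S3c : 0 <= (S2 + (1 + S1)) / c by rewrite divr_ge0// ltW.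
have Td0 : 0 <= T - d by lra.
have Td : 0 <= T - d + (S2 + (1 + S1)) / c by rewrite addr_ge0.
move=> /(_ S2c Td S20 Td0 S3c S30).
have -> : S2 / c + (T - d + (S2 + (1 + S1)) / c) = T.
  rewrite addrCA -mulrDl -/S0 /c invf_div mulrCA divff ?mulr1 ?subrK//.
  by rewrite gt_eqF.
apply: reach_le.
  rewrite add0r -mulrDr -/E0 /c mulrAC ler_pM2r ?invr_gt0//.
  by rewrite lerDl.
rewrite addrCA -mulrDl -/K0 /c invf_div mulrCA mulrC [d * _]mulrC.
have h1 : K0 / S0 * d <= (`|K0 / S0| + 1) * d.
  by rewrite ler_pM2r// (le_trans (ler_norm _))// lerDl.
(* The rest at [y] lasts only [T - d]; as the quadratic form is nonnegative, its cost is at most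
   that of a rest of length [T]. *)
have h2 : 0 <= d * qform P y by rewrite mulr_ge0 ?qform_ge0// ltW.
by move: h1 h2; lra.
Qed.

End Reach.

(** * Energy needed to leave a neighborhood *)

Section RealLemmas.
Context {R : realType}.
Local Notation mu := (@lebesgue_measure R).

Lemma fine_lebesgue_itv (a b : R) (b0 b1 : bool) : a <= b ->
  fine (mu [set` Interval (BSide b0 a) (BSide b1 b)]) = b - a.
Proof.
move=> ab; rewrite lebesgue_measure_itv/= lte_fin; case: ltP => //= ba.
by apply/esym/eqP; rewrite subr_eq0 eq_le ba.
Qed.

Lemma integrable_cst_itv (a b k : R) (b0 b1 : bool) :
  mu.-integrable [set` Interval (BSide b0 a) (BSide b1 b)] (EFin \o cst k).
Proof.
apply: measurable_bounded_integrable => //.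
  by rewrite /= lebesgue_measure_itv/=; case: ifP => _; rewrite ?ltry// -EFinB ltry.
by exists `|k|; split; [exact: num_real|move=> m /ltW km x _].
Qed.

Lemma le_cst_Rintegral (a b k : R) (b0 b1 : bool) (f : R -> R) : a <= b ->
  let I := [set` Interval (BSide b0 a) (BSide b1 b)] in
  mu.-integrable I (EFin \o f) -> (forall t, I t -> k <= f t) ->
  k * (b - a) <= \int[mu]_(t in I) f t.
Proof.
move=> ab I intf kf; rewrite -(fine_lebesgue_itv b0 b1 ab) -Rintegral_cst//.
by apply: le_Rintegral => //; exact: integrable_cst_itv.
Qed.

Lemma Rintegral_itv_split (S t : R) (f : R -> R) : 0 <= t <= S ->
  mu.-integrable `[0, S] (EFin \o f) ->
  \int[mu]_(s in `[0, S]) f s =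
  \int[mu]_(s in `[0, t]) f s + \int[mu]_(s in `]t, S]) f s.
Proof.
move=> /andP[t0 tS] intf; rewrite -(Rintegral_itvB (x := t) intf) ?bnd_simp//.
by rewrite addrC subrK.
Qed.

(** The hitting time is the infimum of the times at which [d] is at least [rho]. *)
Lemma first_hitting (d : R -> R) (s rho : R) : 0 <= s ->
  {within `[0, s], continuous d} -> rho <= d s ->
  exists t, [/\ 0 <= t <= s, rho <= d t & forall t', 0 <= t' < t -> d t' < rho].
Proof.
move=> s0 cd ds; pose B := [set t | 0 <= t <= s /\ rho <= d t].
have Bs : B s by split; rewrite // s0 lexx.
have B0 : lbound B 0 by move=> t [/andP[]].
have hB : has_inf B by split; [exists s|exists 0].
have t0 : 0 <= inf B by apply: lb_le_inf => //; exists s.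
have ts : inf B <= s by apply: ge_inf => //; exists 0.
have infB t' : 0 <= t' < inf B -> d t' < rho.
  move=> /andP[t'0 t't]; rewrite ltNge; apply/negP => dt'.
  have : inf B <= t'.
    apply: ge_inf; first by exists 0.
    by split => //; rewrite t'0 (le_trans (ltW t't)).
  by rewrite leNgt t't.
exists (inf B); split => //; first by rewrite t0.
(* If [d] were below [rho] at the infimum, continuity would keep it below at all nearby times of
   [[0, s]], yet [B] has points arbitrarily close to its infimum. *)
rewrite leNgt; apply/negP => dt.
have tI : `[0, s]%classic (inf B) by rewrite /= in_itv/= t0.
have /subspace_continuousP/(_ _ tI) ct := cd.
have : \forall y \near within `[0, s]%classic (nbhs (inf B)), d y < rho.
  exact: (cvgr_lt _ ct).
rewrite near_withinE => /nbhs_ballP[e /= e0 he].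
have [b Bb be] := inf_adherent e0 hB.
have tb : inf B <= b by apply: ge_inf => //; exists 0.
have [/andP[b0 bs] db] := Bb.
have : d b < rho.
  apply: he; last by rewrite /= in_itv/= b0.
  by rewrite /ball/= ltr_norml; apply/andP; split; lra.
by rewrite ltNge db.
Qed.

End RealLemmas.

(** * Lower bounds on cost and energy along trajectories *)

Section LowerBounds.
Context {R : realType} {n r : nat}.
Local Notation mu := (@lebesgue_measure R).
Variables (g : 'I_r -> 'cV[R]_n -> 'cV[R]_n) (P : 'M[R]_n).
Implicit Types (u : R -> 'cV[R]_r) (x : R -> 'cV[R]_n).
Implicit Types (p q y z : 'cV[R]_n).

(** Follows from the weighted inequality 2|v| <= lam + v^2 / lam for each component; the difference
    of its two sides is a square divided by [lam]. *)
Lemma velocity_le (M lam : R) (w : 'I_r -> R) (v : 'I_r -> R) : 0 < lam ->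
  (forall j, `|w j| <= M) ->
  `|\sum_j v j * w j| <= M / 2 * (r%:R * lam + (\sum_j v j ^+ 2) / lam).
Proof.
move=> l0 wM; apply: (le_trans (ler_norm_sum _ _ _)).
have -> : M / 2 * (r%:R * lam + (\sum_j v j ^+ 2) / lam) =
    \sum_(j < r) M / 2 * (lam + v j ^+ 2 / lam).
  by rewrite -mulr_sumr big_split/= sumr_const card_ord -[lam *+ r]mulr_natl -mulr_suml.
apply: ler_sum => j _; rewrite normrM.
have M0 : 0 <= M by exact: le_trans (wM j).
apply: (@le_trans _ _ (`|v j| * M)); first by rewrite ler_wpM2l.
rewrite mulrC -mulrA ler_wpM2l// ler_pdivlMl//.
have -> : lam + v j ^+ 2 / lam = 2 * `|v j| + (lam - `|v j|) ^+ 2 / lam.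
  rewrite -[v j ^+ 2]real_normK ?num_real//; field.
  by rewrite gt_eqF.
by rewrite lerDl divr_ge0 ?sqr_ge0// ltW.
Qed.

(** The bound of [velocity_le] is integrated over [0, t[. The fields need to be bounded only
    strictly before [t], so that [t] may be the exit time from the region where the bound holds. *)
Lemma displacement_le S p u x (M lam t : R) i : 0 < lam -> 0 <= M -> 0 <= t <= S ->
  admissible g S p u x ->
  (forall s, 0 <= s < t -> forall j, `|g j (x s) i 0| <= M) ->
  `|x t i 0 - p i 0| <= M / 2 * (r%:R * lam * t + energy S u / lam).
Proof.
move=> l0 M0 /andP[t0 tS] [hu hx] gM.
have [iv xE] := hx i.
have e_int := L2_control_integrable hu.
have tI : t \in `[0, S] by rewrite in_itv/= t0.
have sub : mu.-integrable `[0, t[ (EFin \o (fun s => velocity g u x s i 0)).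
  by apply: integrableS iv => //; apply: subset_itvl; rewrite bnd_simp.
have esub : mu.-integrable `[0, t[ (EFin \o (fun s => \sum_j u s j 0 ^+ 2)).
  by apply: integrableS e_int => //; apply: subset_itvl; rewrite bnd_simp.
rewrite (xE _ tI) addrC addKr -Rintegral_itv_bndo_bndc//.
apply: (le_trans (le_normr_Rintegral _ _)) => //.
pose h s := M / 2 * (r%:R * lam) + (M / 2 / lam) * \sum_j u s j 0 ^+ 2.
have iC : mu.-integrable `[0, t[ (EFin \o cst (M / 2 * (r%:R * lam))).
  exact: integrable_cst_itv.
have iZ : mu.-integrable `[0, t[
    (EFin \o (fun s => (M / 2 / lam) * \sum_j u s j 0 ^+ 2)).
  exact: (integrableZl _ (M / 2 / lam) esub).
have ih : mu.-integrable `[0, t[ (EFin \o h) by exact: (integrableD _ iC iZ).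
apply: (@le_trans _ _ (\int[mu]_(s in `[0, t[) h s)).
  apply: le_Rintegral => //; first exact: (integrable_norm sub).
  move=> s /=; rewrite in_itv/= => st.
  rewrite /velocity summxE; under eq_bigr do rewrite mxE.
  apply: (le_trans (velocity_le _ l0 (gM _ st))).
  by rewrite le_eqVlt /h; apply/orP; left; apply/eqP; field; rewrite gt_eqF.
rewrite (RintegralD _ iC iZ)// Rintegral_cst// fine_lebesgue_itv// subr0.
have e_le : \int[mu]_(s in `[0, t[) (\sum_j u s j 0 ^+ 2) <= energy S u.
  rewrite Rintegral_itv_bndo_bndc// /energy.
  rewrite (Rintegral_itv_split (t := t) _ e_int) ?t0//.
  rewrite lerDl.
  by apply: Rintegral_ge0 => s _; apply: sumr_ge0 => j _; exact: sqr_ge0.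
rewrite RintegralZl//.
apply: (@le_trans _ _ (M / 2 * (r%:R * lam) * t + M / 2 / lam * energy S u)).
  by rewrite lerD2l ler_wpM2l// !divr_ge0// ltW.
by rewrite le_eqVlt; apply/orP; left; apply/eqP; field; rewrite gt_eqF.
Qed.

Definition sqdist p z : R := \sum_i (z i 0 - p i 0) ^+ 2.

Lemma sqdist_continuous_comp p (T : topologicalType) (x : T -> 'cV[R]_n) :
  (forall i, continuous (fun t => x t i 0)) -> continuous (fun t => sqdist p (x t)).
Proof.
move=> xc; rewrite (_ : (fun t => _) =
    fun t => \sum_i (x t i 0 - p i 0) * (x t i 0 - p i 0)); last first.
  by apply/funext => t; apply: eq_bigr => i _; rewrite expr2.
apply: continuous_big => [|j _ t]; first exact: add_continuous.
apply: cvgM; (apply: cvgB; [exact: xc|exact: cvg_cst]).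
Qed.

(** Balls of the library are for the sup norm; every coordinate of [z - p] is bounded by the
    Euclidean distance. *)
Lemma near_sqdist p (A : set 'cV[R]_n) : (\forall z \near p, A z) ->
  exists2 rho : R, 0 < rho & forall z, sqdist p z < rho ^+ 2 -> A z.
Proof.
move=> /nbhs_ballP[e /= e0 he]; exists e => // z zp; apply: he; split => // i j.
rewrite ord1 /ball/= -ltr_sqr ?nnegrE ?(ltW e0)// distrC.
apply: le_lt_trans zp; rewrite real_normK ?num_real//.
rewrite /sqdist (bigD1 i)//= lerDl sumr_ge0// => k _; exact: sqr_ge0.
Qed.

Lemma neighborhood_qform_gt_bounded p (a : R) : (forall j, continuous (g j)) ->
  a < qform P p -> exists rho M, [/\ 0 < rho, 0 < M & forall z,
    sqdist p z < rho ^+ 2 -> a < qform P z /\ forall j i, `|g j z i 0| <= M].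
Proof.
(* Near [p] each entry of each field exceeds its value at [p] by at most 1 in absolute value, and
   the sum dominates all these bounds at once. The leading 1 keeps [M] positive when the sum is
   empty. *)
move=> gc ap; pose M := 1 + \sum_j \sum_i (`|g j p i 0| + 1).
have near_q : \forall z \near p, a < qform P z.
  suff qc : qform P @ p --> qform P p by exact: (cvgr_gt _ qc a ap).
  by apply: (qform_continuous_comp (x := id)) => i; exact: coord_continuous.
have near_gji j i : \forall z \near p, `|g j z i 0| <= M.
  have gi : (fun z => g j z i 0) @ p --> g j p i 0.
    apply: (@cvg_comp _ _ _ (g j) (fun v : 'cV[R]_n => v i 0) _ _ _ (gc j p)).
    exact: coord_continuous.
  have near1 : \forall z \near p, g j z i 0 < g j p i 0 + 1.
    by apply: (cvgr_lt _ gi); rewrite ltrDl.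
  have near2 : \forall z \near p, g j p i 0 - 1 < g j z i 0.
    by apply: (cvgr_gt _ gi); rewrite gtrBl.
  apply: filterS2 near1 near2 => z z1 z2.
  have : `|g j z i 0| <= `|g j p i 0| + 1.
    have l1 := ler_norm (g j p i 0); have l2 := ler_norm (- g j p i 0).
    by rewrite normrN in l2; rewrite ler_norml; apply/andP; split; lra.
  move=> /le_trans; apply; rewrite /M (bigD1 j)//= (bigD1 i)//=.
  have s1 : 0 <= \sum_(k < n | k != i) (`|g j p k 0| + 1).
    by apply: sumr_ge0 => k _; rewrite addr_ge0.
  have s2 : 0 <= \sum_(k < r | k != j) \sum_i0 (`|g k p i0 0| + 1).
    by apply: sumr_ge0 => k _; apply: sumr_ge0 => l _; rewrite addr_ge0.
  by lra.
have near_gj j : \forall z \near p, forall i, `|g j z i 0| <= M.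
  exact: filter_forall (near_gji j).
have near_g : \forall z \near p, forall j i, `|g j z i 0| <= M.
  exact: filter_forall near_gj.
have [rho rho0 h] := near_sqdist (filterI near_q near_g).
exists rho, M; split => //.
rewrite /M ltr_wpDr//.
by apply: sumr_ge0 => k _; apply: sumr_ge0 => l _; rewrite addr_ge0.
Qed.

Lemma cost_ge S p u x (a : R) : 0 <= S -> is_trajectory g S p u x ->
  (forall t, 0 <= t <= S -> a <= qform P (x t)) ->
  a * S <= \int[mu]_(t in `[0, S]) qform P (x t).
Proof.
move=> S0 hx ax; rewrite -[X in _ * X]subr0; apply: le_cst_Rintegral => //.
exact: trajectory_qform_integrable hx.
Qed.

Lemma cost_early_ge S p u x (a c s : R) : 0 <= s <= S -> is_trajectory g S p u x ->
  (forall t, 0 <= t <= S -> a <= qform P (x t)) ->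
  (forall t, 0 <= t <= s -> a + c <= qform P (x t)) ->
  a * S + c * s <= \int[mu]_(t in `[0, S]) qform P (x t).
Proof.
move=> /andP[s0 sS] hx ax cx.
have S0 := le_trans s0 sS.
have iq := trajectory_qform_integrable P S0 hx.
rewrite (Rintegral_itv_split (t := s) _ iq) ?s0//.
have -> : a * S + c * s = (a + c) * (s - 0) + a * (S - s) by ring.
apply: lerD; apply: le_cst_Rintegral => //.
- exact: integrable_itv0S iq.
- by apply: integrableS iq => //; apply: subset_itvr; rewrite bnd_simp.
- move=> t /=; rewrite in_itv/= => /andP[st tS]; apply: ax.
  by rewrite tS (le_trans s0 (ltW st)).
Qed.

(** Coordinatewise, 2 a^2 + 2 b^2 - (a + b)^2 = (a - b)^2. *)
Lemma sqdist_triangle p q z :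
  sqdist p z <= 2 * sqdist q z + 2 * sqdist p q.
Proof.
rewrite /sqdist !mulr_sumr -big_split/=; apply: ler_sum => i _.
rewrite -subr_ge0.
have -> : 2 * (z i 0 - q i 0) ^+ 2 + 2 * (q i 0 - p i 0) ^+ 2 -
  (z i 0 - p i 0) ^+ 2 = ((z i 0 - q i 0) - (q i 0 - p i 0)) ^+ 2 by ring.
exact: sqr_ge0.
Qed.

(* The trajectory leaves a fixed neighborhood of p within a time of order eps;
   the weight lam in [displacement_le], which stands in for Cauchy-Schwarz, is
   chosen of order 1/eps. *)
Lemma energy_ge T p (a : R) : 0 < T -> (forall j, continuous (g j)) ->
  a < qform P p -> exists K e0, [/\ 0 < K, 0 < e0 &
  forall eps q u x, 0 < eps < e0 -> admissible g T q u x -> enorm (q - p) < eps ->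
    (forall t, 0 <= t <= T -> a <= qform P (x t)) ->
    \int[mu]_(t in `[0, T]) qform P (x t) <= a * T + eps ->
    K / eps <= energy T u].
Proof.
move=> T0 gc ap; pose c := (qform P p - a) / 2.
have c0 : 0 < c by rewrite divr_gt0// subr_gt0.
have acp : a + c < qform P p by rewrite /c; lra.
have [rho [M [rho0 M0 good]]] := neighborhood_qform_gt_bounded gc acp.
(* With weight [kap / eps], a time at most 2 eps / c and an energy below kap^2 / eps,
   [displacement_le] bounds each coordinate of the displacement by [kap * G]. *)
pose G : R := M / 2 * (r%:R * 2 / c + 1).
have G0 : 0 < G.
  rewrite mulr_gt0 ?[0 < M / 2]divr_gt0//.
  have : 0 <= r%:R * 2 / c.
    by apply: divr_ge0; [exact: mulr_ge0|exact: ltW].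
  by lra.
(* Chosen so that [kap * G] is rho / (2 (n + 1)): [n] coordinates of this size give a Euclidean
   displacement of at most rho / 2. Using n + 1 avoids a division by zero when [n = 0]. *)
pose kap : R := rho / (2 * n.+1%:R * G).
have n0 : 0 < 2 * n.+1%:R :> R by exact: mulr_gt0.
have kap0 : 0 < kap by apply: divr_gt0 => //; exact: mulr_gt0.
have kapG : rho / (2 * n.+1%:R) = kap * G.
  by rewrite /kap; field; rewrite (gt_eqF G0)/= addrC natr1 pnatr_eq0.
have GE : G = M / 2 * (r%:R * 2 / c + 1) by [].
clearbody kap G.
(* The first bound on [eps] ensures [tau <= T] below, the second places the starting point [q]
   within rho / 2 of [p]. *)
exists (kap ^+ 2), (Num.min (c * T / 2) (rho / 2)); split.
- by rewrite exprn_gt0.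
- by rewrite lt_min !divr_gt0// mulr_gt0.
move=> eps q u x /andP[eps0]; rewrite lt_min => /andP[epsT epsrho] adm qp ax xcost.
have [hu hx] := adm.
rewrite leNgt; apply/negP => Ek.
(* Staying in the neighborhood up to time [tau] would add at least c tau = 2 eps to the minimal cost
   [a * T], more than the allowed excess [eps]. *)
pose tau := 2 * eps / c.
have tau0 : 0 < tau by rewrite divr_gt0// mulr_gt0.
have tauT : tau <= T by rewrite /tau ler_pdivrMr// mulrC; lra.
have ctau : c * tau = 2 * eps by rewrite /tau mulrCA divff ?mulr1// gt_eqF.
have [s [/andP[s0 stau] sd]] :
    exists s, 0 <= s <= tau /\ rho ^+ 2 <= sqdist p (x s).
  apply: contrapT => /forallNP nos.
  have : a * T + c * tau <= \int[mu]_(t in `[0, T]) qform P (x t).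
    apply: (cost_early_ge _ hx) => //; first by rewrite (ltW tau0).
    move=> t ttau; have /not_andP[//|/negP] := nos t.
    by rewrite -ltNge => /good[/ltW].
  by rewrite ctau; lra.
have sc : {within `[0, s], continuous (fun t => sqdist p (x t))}.
  apply: (sqdist_continuous_comp (T := subspace `[0, s])) => i.
  apply: trajectory_continuous => //.
  exact: (admissible_sub (le_trans stau tauT) adm).2.
have [t [/andP[t0 ts] td tlt]] := first_hitting s0 sc sd.
have disp i : `|x t i 0 - q i 0| <= rho / (2 * n.+1%:R).
  apply: (@le_trans _ _ (M / 2 * (r%:R * (kap / eps) * t + energy T u / (kap / eps)))).
    apply: (displacement_le _ _ _ adm).
    - by rewrite divr_gt0.
    - exact: ltW.
    - by rewrite t0/= (le_trans ts)// (le_trans stau).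
    - by move=> s' /tlt/good[].
  rewrite kapG GE [leRHS]mulrCA ler_wpM2l ?divr_ge0 ?(ltW M0)// mulrDr mulr1 lerD//.
    have -> : kap * (r%:R * 2 / c) = r%:R * (kap / eps) * tau.
      by rewrite /tau; field; rewrite !gt_eqF.
    by rewrite ler_wpM2l ?(le_trans ts)// mulr_ge0// divr_ge0// ltW.
  rewrite ler_pdivrMr ?divr_gt0//; apply: (le_trans (ltW Ek)).
  by rewrite le_eqVlt; apply/orP; left; apply/eqP; field; rewrite gt_eqF.
have qpd : sqdist p q < eps ^+ 2.
  move: qp; rewrite -ltr_sqr ?nnegrE ?sqrtr_ge0 ?(ltW eps0)// enormK.
  by under eq_bigr do rewrite !mxE.
have xqd : sqdist q (x t) <= rho ^+ 2 / 4.
  apply: (@le_trans _ _ (\sum_(i < n) (rho / (2 * n.+1%:R)) ^+ 2)).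
    apply: ler_sum => i _; rewrite -[leLHS]real_normK ?num_real//.
    by rewrite ler_sqr ?nnegrE// divr_ge0 ?mulr_ge0// ltW.
  rewrite sumr_const card_ord -[leLHS]mulr_natl.
  have -> : n%:R * (rho / (2 * n.+1%:R)) ^+ 2 =
      rho ^+ 2 / 4 * (n%:R / n.+1%:R ^+ 2).
    by field; rewrite addrC natr1 pnatr_eq0.
  rewrite ler_piMr ?divr_ge0 ?sqr_ge0//.
  rewrite ler_pdivrMr ?exprn_gt0// mul1r -natrX ler_nat.
  by rewrite (leq_trans (leqnSn n))// -[leqLHS]expn1 leq_pexp2l.
(* At the exit time the squared distance to [p] is below 2 (rho^2 / 4) + 2 (rho^2 / 4) = rho^2, a
   contradiction. *)
have := sqdist_triangle p q (x t).
have : eps ^+ 2 < (rho / 2) ^+ 2.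
  by rewrite ltr_sqr// nnegrE; [exact: ltW|apply: le_trans (ltW epsrho); exact: ltW].
have -> : (rho / 2) ^+ 2 = rho ^+ 2 / 4 by field.
by move: td xqd qpd; lra.
Qed.

End LowerBounds.

(** * The degree of singularity *)

Section Limits.
Context {R : realType}.

Lemma lne_sqrt (e : R) : 0 < e -> lne (Num.sqrt e)%:E = (2^-1 * ln e)%:E.
Proof. by move=> e0; rewrite lne_EFin ?sqrtr_gt0// -powR12_sqrt ?ln_powR// ltW. Qed.

Lemma near_ln_inv_gt (A : R) : \forall eps \near 0^'+, A < ln (1 / eps).
Proof.
near=> eps; have eps0 : 0 < eps by near: eps; exact: nbhs_right_gt.
rewrite div1r lnV ?posrE// ltrNr -ltr_expR lnK ?posrE//.
near: eps; apply: nbhs_right_lt; exact: expR_gt0.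
Unshelve. all: by end_near. Qed.

Lemma limf_esup_ge (f : R -> \bar R) (l : R) :
  (forall e, 0 < e -> \forall eps \near 0^'+, ((l - e)%:E <= f eps)%E) ->
  (l%:E <= limf_esup f 0^'+)%E.
Proof.
move=> h; rewrite limf_esupE; apply: le_ereal_inf_tmp => _ [V V0 <-].
apply/lee_addgt0Pr => e e0.
have [eps [Veps feps]] := filter_ex (filterI V0 (h e e0)).
rewrite -leeBlDr// -EFinB; apply: (le_trans feps).
by apply: ereal_sup_ubound; exists eps.
Qed.

(** The set where [f] is at most [l + e] is itself one of the neighborhoods over which the infimum
    is taken. *)
Lemma limf_esup_le (f : R -> \bar R) (l : R) :
  (forall e, 0 < e -> \forall eps \near 0^'+, (f eps <= (l + e)%:E)%E) ->
  (limf_esup f 0^'+ <= l%:E)%E.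
Proof.
move=> h; rewrite limf_esupE; apply/lee_addgt0Pr => e e0.
apply: ge_ereal_inf; exists (ereal_sup (f @` [set eps | (f eps <= (l + e)%:E)%E])).
  by exists [set eps | (f eps <= (l + e)%:E)%E] => //; exact: h.
by apply: ge_ereal_sup => _ [eps feps <-].
Qed.

Lemma ln_div_inv (K eps : R) : 0 < K -> 0 < eps ->
  ln (K / eps) = ln K + ln (1 / eps).
Proof. by move=> K0 eps0; rewrite div1r -lnM ?posrE// invr_gt0. Qed.

End Limits.

(** * The value of the infimum and the two bounds on the degree of singularity *)

Section DriftlessProblem.
Context {R : realType} {n r : nat}.
Local Notation mu := (@lebesgue_measure R).
Variables (T : R) (P : 'M[R]_n) (g : 'I_r -> 'cV[R]_n -> 'cV[R]_n).
Variables (x0 xT : 'cV[R]_n).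
Hypotheses (T0 : 0 < T) (posP : posdef_sym P).
Implicit Types (u : R -> 'cV[R]_r) (x : R -> 'cV[R]_n).

Lemma attainable_refl : attainable g x0 x0.
Proof. by exists 0, (cst 0), (cst x0); split => //; exact: admissible_cst. Qed.

Lemma attainable_along S p u x t : 0 <= t <= S -> admissible g S p u x ->
  attainable g p (x t).
Proof.
move=> /andP[t0 tS] adm; exists t, u, x; split => //.
exact: admissible_sub adm.
Qed.

Lemma alpha_le y : attainable g x0 y -> (alpha g P x0 <= (qform P y)%:E)%E.
Proof. by move=> y0; apply: ereal_inf_lbound; exists y. Qed.

Lemma alpha_fin_num : alpha g P x0 \is a fin_num.
Proof.
rewrite ge0_fin_numE.
  by rewrite (le_lt_trans (alpha_le attainable_refl))// ltry.
by apply: le_ereal_inf_tmp => _ [y _ <-]; rewrite lee_fin qform_ge0.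
Qed.

Let a := fine (alpha g P x0).

Let alphaE : alpha g P x0 = a%:E.
Proof. by rewrite fineK// alpha_fin_num. Qed.

Let a_le y : attainable g x0 y -> a <= qform P y.
Proof. by move=> /alpha_le; rewrite alphaE lee_fin. Qed.

Let a_le_along u x : admissible g T x0 u x ->
  forall t, 0 <= t <= T -> a <= qform P (x t).
Proof. by move=> adm t tT; apply: a_le; exact: attainable_along adm. Qed.

Lemma costE p u x : is_trajectory g T p u x ->
  cost P T x = (\int[mu]_(t in `[0, T]) qform P (x t))%:E.
Proof.
move=> hx; rewrite /cost /Rintegral fineK//; apply: integrable_fin_num => //.
exact: trajectory_qform_integrable (ltW T0) hx.
Qed.

Lemma inf_cost_le E K : reach g P x0 xT T E K ->
  (inf_cost g P T x0 xT <= K%:E)%E.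
Proof.
move=> [u [x [adm xq _ xK]]]; apply: ge_ereal_inf.
exists (cost P T x); first by exists u, x.
by rewrite (costE adm.2) lee_fin.
Qed.

Lemma inf_costE : attainable g x0 xT ->
  inf_cost g P T x0 xT = (alpha g P x0 * T%:E)%E.
Proof.
move=> xT0; rewrite alphaE -EFinM; apply/eqP; rewrite eq_le; apply/andP; split.
  apply/lee_addgt0Pr => e e0; rewrite -EFinD.
  (* Half of [e] pays for the choice of [y], whose value exceeds alpha by less than e / (2 T) during
     a time [T]; the other half pays for the motions, through K d <= e / 2. *)
  have eT : 0 < e / (2 * T) by rewrite divr_gt0// mulr_gt0.
  have [_ [y y0 <-]] := lb_ereal_inf_adherent eT alpha_fin_num.
  rewrite -/(alpha g P x0) alphaE -EFinD lte_fin => ya.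
  have [E [K [_ K0 hEK]]] := reach_resting posP T0 xT0 y0.
  pose d := Num.min (T / 2) (e / (2 * K)).
  have d0 : 0 < d by rewrite lt_min !divr_gt0// mulr_gt0.
  have half_T : T / 2 < T by rewrite ltr_pdivrMr// ltr_pMr// ltr1n.
  have dT : d < T by apply: le_lt_trans half_T; rewrite ge_min lexx.
  have Kd : K * d <= e / 2.
    apply: (@le_trans _ _ (K * (e / (2 * K)))).
      by rewrite ler_pM2l// ge_min lexx orbT.
    by rewrite le_eqVlt; apply/orP; left; apply/eqP; field; rewrite gt_eqF.
  apply: le_trans (inf_cost_le (hEK d _)) _; first by rewrite d0.
  rewrite lee_fin.
  have : T * qform P y <= T * (a + e / (2 * T)) by rewrite ler_pM2l// ltW.
  have -> : T * (a + e / (2 * T)) = a * T + e / 2 by field; rewrite gt_eqF.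
  by lra.
apply: le_ereal_inf_tmp => _ [u [x [adm _ ->]]].
rewrite (costE adm.2) lee_fin; apply: cost_ge (ltW T0) adm.2 _.
exact: (a_le_along adm).
Qed.

Hypothesis xT0 : attainable g x0 xT.

Lemma near_optimalP eps u : near_optimal g P T x0 xT eps u <-> exists x,
  [/\ admissible g T x0 u x,
      \int[mu]_(t in `[0, T]) qform P (x t) <= a * T + eps &
      enorm (x T - xT) < eps].
Proof.
rewrite /near_optimal/= inf_costE// alphaE -EFinM -EFinD.
by split => -[x [adm xc xe]]; exists x; split => //; move: xc;
  rewrite (costE adm.2) lee_fin.
Qed.

Lemma near_optimal_energy_ge : (forall j, continuous (g j)) ->
  ~ ((qform P x0)%:E = alpha g P x0 /\ (qform P xT)%:E = alpha g P x0) ->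
  exists K e0, [/\ 0 < K, 0 < e0 & forall eps u, 0 < eps < e0 ->
    near_optimal g P T x0 xT eps u -> L2_control T u /\ K / eps <= energy T u].
Proof.
move=> gc /not_andP notmin.
have : a < qform P x0 \/ a < qform P xT.
  by case: notmin => /eqP; rewrite alphaE eqe => ne; [left|right];
    rewrite lt_neqAle eq_sym ne a_le//; exact: attainable_refl.
case=> [/(energy_ge T0 gc)|/(energy_ge T0 gc)] [K [e0 [K0 e00 h]]];
    exists K, e0; split => // eps u epse0 /near_optimalP[x [adm xc xe]];
    split; try exact: adm.1.
  have [eps0 _] := andP epse0.
  apply: h epse0 adm _ (a_le_along adm) xc.
  by rewrite subrr /enorm big1 ?sqrtr0// => i _; rewrite mxE expr0n.
(* The reversed trajectory starts at [x T], only known to be within [eps] of [xT]; this is why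
   [energy_ge] lets the starting point [q] differ from [p]. *)
have T0' := ltW T0.
rewrite -(energy_reverse T0' adm.1).
apply: h epse0 (admissible_reverse T0' adm) xe _ _.
  move=> t tT; apply: (a_le_along adm); move: tT => /andP[t0 tT].
  by apply/andP; split; lra.
have iq := trajectory_qform_integrable P T0' adm.2.
have := @Rintegral_reverse _ T T _ _ iq; rewrite T0' lexx subrr set_itv1.
by rewrite Rintegral_set1 subr0 => /(_ isT) ->.
Qed.

(** An energy of at least K / eps makes ln of the norm at least (ln K + ln (1 / eps)) / 2; after
    division by ln (1 / eps) the contribution of [K] tends to 0. *)
Lemma singularity_degree_ge : (forall j, continuous (g j)) ->
  ~ ((qform P x0)%:E = alpha g P x0 /\ (qform P xT)%:E = alpha g P x0) ->
  ((1 / 2 : R)%:E <= singularity_degree g P T x0 xT)%E.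
Proof.
move=> gc notmin.
have [K [e0 [K0 e00 h]]] := near_optimal_energy_ge gc notmin.
apply: limf_esup_ge => e e_gt0; near=> eps.
have eps0 : 0 < eps by near: eps; exact: nbhs_right_gt.
have epse0 : eps < e0 by near: eps; exact: nbhs_right_lt.
have L0 : 0 < ln (1 / eps) by near: eps; exact: near_ln_inv_gt.
(* For such [eps] the constant ln K / 2 is absorbed by the slack e ln (1 / eps). *)
have LK : - (2^-1 * ln K) / e < ln (1 / eps) by near: eps; exact: near_ln_inv_gt.
set L := ln (1 / eps) in L0 LK *.
rewrite inver gt_eqF// lee_pdivlMr// -EFinM; apply: le_ereal_inf_tmp => _ [u uo <-].
have [hu Ku] := h eps u (introT andP (conj eps0 epse0)) uo.
have Keps : 0 < K / eps by exact: divr_gt0.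
have E0 : 0 < energy T u by exact: lt_le_trans Ku.
rewrite L2normE// lne_sqrt// lee_fin.
have : ln (K / eps) <= ln (energy T u) by rewrite ler_ln ?posrE.
rewrite ln_div_inv// -/L; move: LK; rewrite ltr_pdivrMr//.
by lra.
Unshelve. all: by end_near. Qed.

Lemma singularity_degree_le y : attainable g x0 y ->
  (qform P y)%:E = alpha g P x0 ->
  (singularity_degree g P T x0 xT <= (1 / 2 : R)%:E)%E.
Proof.
move=> y0 /eqP; rewrite alphaE eqe => /eqP ya.
have [E [K [E0 K0 hEK]]] := reach_resting posP T0 xT0 y0.
apply: limf_esup_le => e e_gt0; near=> eps.
have eps0 : 0 < eps by near: eps; exact: nbhs_right_gt.
have epsKT : eps < K * T by near: eps; apply: nbhs_right_lt; exact: mulr_gt0.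
have L0 : 0 < ln (1 / eps) by near: eps; exact: near_ln_inv_gt.
have LK : (2^-1 * ln (E * K)) / e < ln (1 / eps) by near: eps; exact: near_ln_inv_gt.
set L := ln (1 / eps) in L0 LK *.
(* The motions take time d = eps / K, so that the excess cost K d is exactly [eps]; [eps < K * T]
   gives d < T. *)
have [|u [x [adm xq uE xc]]] := hEK (eps / K).
  by rewrite divr_gt0// ltr_pdivrMr// mulrC.
have Keps : K * (eps / K) = eps by rewrite mulrCA divff ?mulr1// gt_eqF.
have uo : near_optimal g P T x0 xT eps u.
  apply/near_optimalP; exists x; split => //.
    by rewrite mulrC -ya -[X in _ + X]Keps.
  by rewrite xq subrr /enorm big1 ?sqrtr0// => i _; rewrite mxE expr0n.
rewrite inver gt_eqF// lee_pdivrMr// -EFinM; apply: ge_ereal_inf.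
exists (lne (L2norm T u)); first by exists u.
rewrite L2normE; last exact: adm.1.
(* A control of zero energy has logarithm -oo, for which the bound is trivial. *)
have [E1|Epos] := leP (energy T u) 0.
  by rewrite le0_lneNy ?leNye// lee_fin ler0_sqrtr.
rewrite lne_sqrt// lee_fin.
have EKeps : E / (eps / K) = E * K / eps by field; rewrite !gt_eqF.
have : ln (energy T u) <= ln (E * K / eps).
  by rewrite -EKeps ler_ln ?posrE//; apply: lt_le_trans uE.
rewrite ln_div_inv ?mulr_gt0// -/L; move: LK; rewrite ltr_pdivrMr//.
by lra.
Unshelve. all: by end_near. Qed.

End DriftlessProblem.

Theorem theorem6p1 (R : realType) (n r : nat) (T : R) (P : 'M[R]_n)
    (g : 'I_r -> 'cV[R]_n -> 'cV[R]_n) (x0 xT : 'cV[R]_n) :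
  0 < T ->
  posdef_sym P ->
  (forall j : 'I_r, smooth (g j)) ->
  attainable g x0 xT ->
  [/\ inf_cost g P T x0 xT = (alpha g P x0 * T%:E)%E,
      ~ ((qform P x0)%:E = alpha g P x0 /\ (qform P xT)%:E = alpha g P x0) ->
        ((1 / 2 : R)%:E <= singularity_degree g P T x0 xT)%E
    & (exists2 y, attainable g x0 y & (qform P y)%:E = alpha g P x0) ->
        (singularity_degree g P T x0 xT <= (1 / 2 : R)%:E)%E].
Proof.
move=> T0 posP smooth_g xT0; split.
- exact: inf_costE.
(* At level 0, [class_C] is continuity. *)
- by apply: singularity_degree_ge => // j; exact: (smooth_g j 0%N).
- by move=> [y]; exact: singularity_degree_le.
Qed.
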